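(* Let $\Delta$ be a positive integer, let $n$ be a positive integer, and let $G$ be a graph with minimum degree at least $10^7\Delta$ and maximum degree at most $\exp(\Delta/10^9)$ such that every subgraph of $G$ on at most $(10^7\Delta+1)n$ vertices has average degree at most $12/5$. Then $G$ contains every tree with maximum degree at most $\Delta$ on $n$ vertices as an induced subgraph. *)

(* Defs.v *)
From Stdlib Require Import Reals.
From mathcomp Require Import all_boot.
Set Implicit Arguments. Unset Strict Implicit. Unset Printing Implicit Defensive.

Definition simple_graph (V : finType) (e : rel V) : Prop :=
  symmetric e /\ irreflexive e.

Definition deg (V : finType) (e : rel V) (v : V) : nat := #|[set u | e v u]|.

Definition is_subgraph (V : finType) (e : rel V) (S : {set V}) (f : rel V) : Prop :=
  symmetric f /\ (forall x y, f x y -> [&& e x y, x \in S & y \in S]).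

Definition sub_deg (V : finType) (S : {set V}) (f : rel V) (v : V) : nat :=
  #|[set u in S | f v u]|.

(* average degree of (S, f) is at most 12/5 :
   (sum of degrees) / |S| <= 12/5, written without division
   (vacuous for the empty subgraph). *)
Definition avg_deg_le_12_5 (V : finType) (S : {set V}) (f : rel V) : Prop :=
  5 * (\sum_(v in S) sub_deg S f v) <= 12 * #|S|.

Definition connected_graph (T : finType) (t : rel T) : Prop :=
  forall x y : T, connect t x y.

Definition acyclic_graph (T : finType) (t : rel T) : Prop :=
  forall p : seq T, uniq p -> 3 <= size p -> ~~ cycle t p.

Definition is_tree (T : finType) (t : rel T) : Prop :=
  simple_graph t /\ connected_graph t /\ acyclic_graph t.

Definition induced_copy (T V : finType) (t : rel T) (e : rel V) : Prop :=
  exists phi : T -> V, injective phi /\ forall x y : T, t x y = e (phi x) (phi y).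

(* Main.v *)
(* Give every vertex [v] a list [L v] of [D = 100 Delta] neighbours and embed
   the tree vertex by vertex.  A list element is spoiled if it is occupied or
   adjacent to an occupied vertex other than [v].  As long as few elements of
   [L v] are spoiled, [v] can receive a new child there.  Once [4/5] of [L v]
   is spoiled, [v] joins a set [B] and reserves [Delta] unspoiled list elements
   for its future children; reserved vertices count as occupied.

   One new vertex may push many vertices into [B] at once, and their
   reservations may push further ones.  So [B] is enlarged to a maximal set
   each of whose members is overspoiled even when all the lists of [B] are
   counted as occupied; sparsity of the hull [S u B u L(B)] bounds [|B|] by a
   small fraction of [n].  The reservations of the new members are then made
   compatible greedily: by sparsity again, some member has many candidates with
   no second neighbour among all members and candidates, so it can choose first
   without harming the others. *)
Require Import Defs.
From Stdlib Require Import Reals.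
From mathcomp Require Import all_boot.
From mathcomp Require Import zify.
Set Implicit Arguments. Unset Strict Implicit. Unset Printing Implicit Defensive.

(** * Spoiled lists and edge counts in a locally sparse graph *)

Section SparseGraph.

Variables (V : finType) (e : rel V) (N : nat).
Hypothesis e_sym : symmetric e.
Hypothesis e_sparse : forall S : {set V}, #|S| <= N ->
  5 * (\sum_(v in S) sub_deg S e v) <= 12 * #|S|.

Implicit Types (S P B C Z : {set V}) (A L F : V -> {set V}).

(** [S] and [Z] coincide with the occupied set when a child is to be placed; the test for membership
    in [B] takes the image as [S] and the larger hull as [Z]. *)
Definition spoiled S Z (M : {set V}) (b : V) : {set V} :=
  [set w in M | (w \in S) || [exists x in Z, (x != b) && e w x]].

Lemma spoiledP S Z (M : {set V}) b w :
  reflect (w \in M /\ (w \in S \/ exists x, [/\ x \in Z, x != b & e w x]))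
          (w \in spoiled S Z M b).
Proof.
rewrite inE; apply: (iffP andP) => [[-> /orP[->|/existsP[x /and3P[? ? ?]]]]|].
- by split=> //; left.
- by split=> //; right; exists x.
case=> -> [->|[x [xZ xb wx]]]; split=> //.
by apply/orP; right; apply/existsP; exists x; rewrite xZ xb wx.
Qed.

Lemma spoiled_sub S Z (M : {set V}) b : spoiled S Z M b \subset M.
Proof. by apply/subsetP=> w /spoiledP[]. Qed.

Lemma spoiledS S S' Z Z' (M : {set V}) b :
  S \subset S' -> Z \subset Z' -> spoiled S Z M b \subset spoiled S' Z' M b.
Proof.
move=> /subsetP sS /subsetP sZ; apply/subsetP=> w /spoiledP[wM H].
apply/spoiledP; split=> //; case: H => [/sS|[x [/sZ ? ? ?]]]; first by left.
by right; exists x.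
Qed.

Lemma card_bigcup_le (B : {set V}) A k :
  (forall b, b \in B -> #|A b| <= k) -> #|\bigcup_(b in B) A b| <= k * #|B|.
Proof.
move=> Ak; rewrite mulnC -sum_nat_const.
elim/big_rec2: _ => [|b m X bB IH]; first by rewrite cards0.
by rewrite (leq_trans (leq_card_setU _ _)) // leq_add // Ak.
Qed.

Definition hull S B A : {set V} := S :|: B :|: \bigcup_(b in B) A b.

Lemma hullS S S' B B' A :
  S \subset S' -> B \subset B' -> hull S B A \subset hull S' B' A.
Proof.
move=> sS sB; rewrite /hull !setUSS //.
by apply/bigcupsP=> b bB; apply: bigcup_sup; apply: (subsetP sB).
Qed.

Lemma card_hull_le S B A a : (forall b, b \in B -> #|A b| <= a) ->
  #|hull S B A| <= #|S| + a.+1 * #|B|.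
Proof.
move=> /card_bigcup_le Aa; rewrite /hull.
have := (leq_card_setU (S :|: B) (\bigcup_(b in B) A b)).1.
by have := (leq_card_setU S B).1; lia.
Qed.

(* A vertex of [B] has degree at least [a] in the hull and most elements of
   its list have degree at least 2, so the hull has average degree about
   [1 + 2 - 1/5 > 12/5] unless [a * #|B|] is comparable to [#|S|]. *)
Lemma card_overspoiled S B A a :
  (forall b, b \in B -> #|A b| = a) ->
  (forall b w, b \in B -> w \in A b -> e b w) ->
  #|hull S B A| <= N ->
  (forall b, b \in B -> 4 * a <= 5 * #|spoiled S (hull S B A) (A b) b|) ->
  2 * (a * #|B|) <= 12 * #|S| + 12 * #|B|.
Proof.
move=> cA eA; set Z := hull S B A => ZN spA.
pose W := (\bigcup_(b in B) A b) :\: (S :|: B).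
pose d := sub_deg Z e.
pose W1 := [set w in W | d w <= 1].
have AZ b w : b \in B -> w \in A b -> w \in Z.
  by move=> bB wA; rewrite inE; apply/orP; right; apply/bigcupP; exists b.
have BZ b : b \in B -> b \in Z by move=> bB; rewrite !inE bB orbT.
have ZE : Z = (S :|: B) :|: W by apply/setP=> w; rewrite /W !inE; case: (_ \in S); case: (_ \in B).
have cZ : #|Z| <= #|S| + #|B| + #|W|.
  have := (leq_card_setU (S :|: B) W).1; rewrite -ZE.
  by have := (leq_card_setU S B).1; lia.
have dBW : [disjoint B & W].
  rewrite disjoint_sym disjoints_subset.
  by apply/subsetP=> w; rewrite !inE negb_or => /andP[/andP[]].
have sumZ : \sum_(v in B) d v + \sum_(v in W) d v <= \sum_(v in Z) d v.
  rewrite [leqRHS](big_setID B) /= [X in _ <= _ + X](big_setID W) /=.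
  have -> : Z :&: B = B by apply/setIidPr; rewrite ZE -setUA subsetU // subsetUl orbT.
  have -> : (Z :\: B) :&: W = W.
    by apply/setIidPr; rewrite subsetD disjoint_sym dBW ZE subsetUr.
  by rewrite leq_add2l leq_addr.
have sumB : a * #|B| <= \sum_(v in B) d v.
  rewrite mulnC -sum_nat_const; apply: leq_sum => b bB.
  rewrite -(cA b bB); apply: subset_leq_card.
  by apply/subsetP=> w wA; rewrite inE (AZ b) // eA.
(* Each vertex of [W] has a neighbour in [B], so only those in [W1] miss degree 2, and by exactly
   one. *)
have sumW : 2 * #|W| <= \sum_(v in W) d v + #|W1|.
  have -> : #|W1| = \sum_(v in W) (d v <= 1).
    rewrite -sum1_card (eq_bigl (fun v => (v \in W) && (d v <= 1))); last first.
      by move=> v; rewrite inE.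
    by rewrite big_mkcondr /=; apply: eq_bigr => v _; case: (d v <= 1).
  rewrite -big_split mulnC -sum_nat_const /=; apply: leq_sum => w wW.
  have : 0 < d w; last by case: (d w) => [|[|m]].
  have /setDP[/bigcupP[b bB wA] _] := wW.
  by apply/card_gt0P; exists b; rewrite inE BZ // e_sym eA.
have cW : #|W| <= a * #|B|.
  apply: (leq_trans (subset_leq_card (subsetDl _ _))).
  by apply: card_bigcup_le => b bB; rewrite cA.
(* A spoiled list element outside [S] has a second neighbour in [Z], so [W1] meets each list only in
   its unspoiled part, at most a fifth of it. *)
have cW1 : 5 * #|W1| <= a * #|B|.
  have sW1 : W1 \subset \bigcup_(b in B) (W1 :&: A b).
    apply/subsetP=> w wW1; move: (wW1); rewrite inE => /andP[/setDP[/bigcupP[b bB wA] _] _].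
    by apply/bigcupP; exists b => //; rewrite inE wW1.
  have : #|W1| <= (a %/ 5) * #|B|.
    apply: (leq_trans (subset_leq_card sW1)); apply: card_bigcup_le => b bB.
    have dis : [disjoint W1 :&: A b & spoiled S Z (A b) b].
      rewrite disjoints_subset; apply/subsetP=> w /setIP[wW1 wA]; rewrite inE.
      apply/negP=> /spoiledP[_]; move: wW1; rewrite !inE => /andP[/andP[wSB _] dw].
      move: wSB; rewrite negb_or => /andP[/negPf-> _] [//|[x [xZ xb wx]]].
      have : #|[set b; x]| <= d w.
        apply: subset_leq_card; apply/subsetP=> y /set2P[->|->]; rewrite inE.
          by rewrite BZ // e_sym eA.
        by rewrite xZ.
      by rewrite cards2 eq_sym xb; lia.
    have : #|W1 :&: A b| + #|spoiled S Z (A b) b| <= a.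
      rewrite -(cA b bB) -cardsUI (disjoint_setI0 dis) cards0 addn0.
      by apply: subset_leq_card; rewrite subUset subsetIr spoiled_sub.
    by have := spA b bB; lia.
  by nia.
have : 5 * \sum_(v in Z) d v <= 12 * #|Z| := e_sparse ZN.
(* The bounds combine to [5 * a * #|B| <= 12 * #|S| + 12 * #|B| + 2 * #|W| + 5 * #|W1|], and the
   last two terms are at most [3 * a * #|B|]. *)
lia.
Qed.

Lemma exists_subset_card (X : {set V}) k :
  k <= #|X| -> exists2 Y : {set V}, Y \subset X & #|Y| = k.
Proof.
move=> kX; exists [set x in take k (enum X)].
  by apply/subsetP=> x; rewrite inE => /mem_take; rewrite mem_enum.
rewrite cardsE; have /card_uniqP-> : uniq (take k (enum X)) by rewrite take_uniq ?enum_uniq.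
by rewrite size_take -cardE; case: ltngtP kX.
Qed.

(* Greedy choice along a degeneracy order: some [c] has few list elements that
   have a second neighbour in the hull; choose [F c] among the others and
   continue with [C :\ c]. *)
Lemma independent_transversal C A a k :
  (forall c, c \in C -> #|A c| = a) ->
  (forall c w, c \in C -> w \in A c -> e c w) ->
  6 < a -> 5 * k <= a -> a.+1 * #|C| <= N ->
  exists F, [/\ forall c, c \in C -> F c \subset A c /\ #|F c| = k,
    forall c c' w, c \in C -> c' \in C -> w \in F c -> w \in F c' -> c = c' &
    forall c c' w q, c \in C -> c' \in C -> 
      w \in F c -> q \in F c' -> e w q -> q = c \/ w = c'].
Proof.
move=> + + a6 ka; have [m] := ubnP #|C|.
elim: m C => // m IH C Cm cA eA CN.
have [->|/set0Pn C0] := eqVneq C set0.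
  by exists (fun=> set0); split=> [c|c c' w|c c' w q]; rewrite inE.
pose Y := hull set0 C A.
have cY : #|Y| <= N.
  apply: leq_trans CN; have := @card_hull_le set0 C A a _.
  by rewrite cards0; apply=> c /cA->.
(* If all lists were overspoiled, the edge count with [S] empty would give [2 * a <= 12], against
   [6 < a]. *)
have [c cC few] : exists2 c, c \in C & 5 * #|spoiled set0 Y (A c) c| < 4 * a.
  case: (boolP [exists c in C, 5 * #|spoiled set0 Y (A c) c| < 4 * a]).
    by case/existsP=> c /andP[]; exists c.
  rewrite negb_exists => /forallP H; exfalso.
  have C_gt0 : 0 < #|C| by apply/card_gt0P.
  have := @card_overspoiled set0 C A a cA eA cY.
  rewrite cards0; suff sp : forall b, b \in C -> 4 * a <= 5 * #|spoiled set0 Y (A b) b|.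
    by move=> /(_ sp); nia.
  by move=> b bC; have := H b; rewrite bC /= -leqNgt.
have [F0 sF0 cF0] : exists2 X : {set V}, X \subset A c :\: spoiled set0 Y (A c) c & #|X| = k.
  apply: exists_subset_card; have := cardsDS (spoiled_sub set0 Y (A c) c).
  by rewrite cA //; lia.
(* Within the hull, elements of [F0] are adjacent to [c] only; all other members and their later
   choices lie in the hull, so none can conflict with [F0]. *)
have F0_free w x : w \in F0 -> x \in Y -> e w x -> x = c.
  move=> /(subsetP sF0)/setDP[wA /spoiledP nsp] xY wx; apply/eqP/negP=> /negP xc.
  by apply: nsp; split=> //; right; exists x.
have cC1 : #|C| = #|C :\ c|.+1 by rewrite (cardsD1 c) cC.
have [|x /setD1P[_ /cA]|x w /setD1P[_ /eA]||F [FA Finj Find]] := IH (C :\ c) => //.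
- by rewrite -ltnS -cC1.
- by move=> H /H.
- by apply: leq_trans CN; rewrite leq_mul // cC1.
have FY c' w : c' \in C :\ c -> w \in F c' -> w \in A c' /\ w \in Y.
  move=> c'C wF; have [/subsetP/(_ _ wF) wA _] := FA _ c'C; split=> //.
  by rewrite inE; apply/orP; right; apply/bigcupP; exists c' => //; case/setD1P: c'C.
have F0A w : w \in F0 -> w \in A c by move/(subsetP sF0)/setDP=> [].
have F0Y w : w \in F0 -> w \in Y.
  by move/F0A=> wA; rewrite inE; apply/orP; right; apply/bigcupP; exists c.
have CY x : x \in C -> x \in Y by move=> xC; rewrite !inE xC ?orbT.
have cross c' w : c' \in C -> c' != c -> w \in F0 -> w \in F c' -> False.
  move=> c'C c'c wF0 wF; have c'D : c' \in C :\ c by rewrite !inE c'c.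
  have [wA _] := FY _ _ c'D wF.
  by case/eqP: c'c; apply: (F0_free w) => //; [exact: CY | rewrite e_sym eA].
exists (fun x => if x == c then F0 else F x); split.
- move=> x xC; case: eqP => [->|/eqP xc]; last by apply: FA; rewrite !inE xc.
  by split=> //; apply/subsetP.
- move=> x y w xC yC; case: eqP => [->|/eqP xc]; case: eqP => [->|/eqP yc] //.
  + by move=> h1 h2; case: (cross y w).
  + by move=> h1 h2; case: (cross x w).
  + by apply: Finj; rewrite !inE ?xc ?yc.
move=> x y w q xC yC; case: eqP => [->|/eqP xc]; case: eqP => [->|/eqP yc] h1 h2 wq.
- by left; apply: F0_free wq => //; apply: F0Y.
- have yD : y \in C :\ c by rewrite !inE yc.
  by left; apply: F0_free wq => //; have [] := FY _ _ yD h2.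
- have xD : x \in C :\ c by rewrite !inE xc.
  by right; apply: (F0_free q); rewrite 1?e_sym //; have [] := FY _ _ xD h1.
- by apply: Find wq; rewrite // !inE ?xc ?yc.
Qed.

(** Seven common neighbours would serve as the list of both [u] and [v]. Each is spoiled by the
    other vertex, so the edge count would give [28 <= 24]; the hull has at most [2 * 8 = 16]
    vertices. *)
Lemma card_common_neighbours (u v : V) (X : {set V}) :
  16 <= N -> u != v -> (forall w, w \in X -> e u w /\ e v w) -> #|X| <= 6.
Proof.
move=> N16 uv eX; rewrite leqNgt; apply/negP=> X7.
have [Y sYX cY] := exists_subset_card X7.
have eB b w : b \in [set u; v] -> w \in Y -> e b w.
  by move=> /set2P[]-> /(subsetP sYX)/eX[].
have cB : #|[set u; v]| = 2 by rewrite cards2 uv.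
suff: 2 * (7 * #|[set u; v]|) <= 12 * #|@set0 V| + 12 * #|[set u; v]|.
  by rewrite cB cards0.
apply: (@card_overspoiled _ _ (fun=> Y)) => // [|b bB].
  apply: leq_trans N16; have := @card_hull_le set0 [set u; v] (fun=> Y) 7 _.
  by rewrite cB cards0; apply=> b _; rewrite cY.
suff -> : spoiled set0 (hull set0 [set u; v] (fun=> Y)) Y b = Y by rewrite cY.
apply/eqP; rewrite eqEsubset spoiled_sub; apply/subsetP=> w wY.
apply/spoiledP; split=> //; right.
exists (if b == u then v else u); split.
- by rewrite !inE; case: ifP; rewrite eqxx ?orbT.
- case: ifP => [/eqP->|/negbT]; first by rewrite eq_sym.
  by rewrite eq_sym.
- by rewrite e_sym eB //; case: ifP; rewrite !inE eqxx ?orbT.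
Qed.

(** A newly occupied [u] spoils at most itself and the at most 6 common neighbours of [u] and [v].
    Scaled by 5, this is the slack 35 used below. *)
Lemma card_spoiledU1 P (M : {set V}) (u v : V) :
  16 <= N -> (forall w, w \in M -> e v w) ->
  #|spoiled (u |: P) (u |: P) M v| <= #|spoiled P P M v| + 7.
Proof.
move=> N16 eM.
pose X := [set w in M | (u != v) && e u w].
have cX : #|X| <= 6.
  have [uv|uv] := eqVneq u v.
    suff -> : X = set0 by rewrite cards0.
    by apply/setP=> w; rewrite !inE uv eqxx andbF.
  by apply: (card_common_neighbours N16 uv) => w; rewrite inE uv => /andP[/eM].
have sub : spoiled (u |: P) (u |: P) M v \subset spoiled P P M v :|: (u |: X).
  apply/subsetP=> w /spoiledP[wM].
  case=> [/setU1P[->|wP]|[x [/setU1P[->|xP] xv wx]]]; rewrite in_setU.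
  - by rewrite setU11 orbT.
  - by apply/orP; left; apply/spoiledP; split=> //; left.
  - by rewrite !inE wM xv e_sym wx !orbT.
  - by apply/orP; left; apply/spoiledP; split=> //; right; exists x.
have := subset_leq_card sub; have := (leq_card_setU (spoiled P P M v) (u |: X)).1.
by rewrite cardsU1; case: (u \notin X); lia.
Qed.

End SparseGraph.

(** * Extending an induced embedding while reserving vertices *)

Section Embedding.

Variables (Delta n : nat) (V : finType) (e : rel V).
Let D := 100 * Delta.
Hypothesis Delta_gt0 : 0 < Delta.
Hypothesis e_sym : symmetric e.
Hypothesis e_irr : irreflexive e.
Hypothesis e_sparse : forall S : {set V}, #|S| <= D.+1 * n ->
  5 * (\sum_(v in S) sub_deg S e v) <= 12 * #|S|.
Variable L : V -> {set V}.
Hypothesis L_adj : forall v w, w \in L v -> e v w.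
Hypothesis L_card : forall v, #|L v| = D.
Variables (T : finType) (t : rel T).
Hypothesis t_sym : symmetric t.
Hypothesis t_irr : irreflexive t.
Hypothesis t_deg : forall x, deg t x <= Delta.

Implicit Types (X : {set T}) (phi : T -> V) (S B : {set V}) (F : V -> {set V}).

Definition occupied S B F : {set V} := S :|: \bigcup_(b in B) F b.

(* [B] contains the vertices whose list was almost entirely spoiled at some
   point; for those, the set [F b] is reserved for the images of the tree
   neighbours that are not yet embedded.  The parameter [s] is the slack that
   appears when a vertex has just been embedded. *)
Record reserving_embedding (s : nat) X phi B F : Prop := ReservingEmbedding {
  re_inj : {in X &, injective phi};
  re_ind : {in X &, forall x y, t x y = e (phi x) (phi y)};
  re_sub : forall b, b \in B -> F b \subset L b /\ #|F b| = Delta;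
  re_disj : forall b c w, b \in B -> c \in B -> w \in F b -> w \in F c -> b = c;
  re_edge : forall p q, p \in occupied (phi @: X) B F ->
    q \in occupied (phi @: X) B F -> e p q ->
    [\/ p \in phi @: X /\ q \in phi @: X, p \in B /\ q \in F p | q \in B /\ p \in F q];
  re_used : forall b w, b \in B -> w \in F b -> w \in phi @: X -> b \in phi @: X;
  re_free : forall v, v \notin B ->
    5 * #|spoiled e (occupied (phi @: X) B F) (occupied (phi @: X) B F) (L v) v|
      < 4 * D + s;
  re_over : forall b, b \in B ->
    4 * D <= 5 * #|spoiled e (phi @: X) (hull (phi @: X) B L) (L b) b|;
  re_card : 2 * #|B| <= n }.

Lemma reserve_overspoiled X phi B F :
  1 < n -> #|X| <= n -> reserving_embedding 35 X phi B F ->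
  exists B' F', reserving_embedding 0 X phi B' F'.
Proof.
move=> n1 Xn st; set S := phi @: X.
have Sn : #|S| <= n by apply: leq_trans Xn; apply: leq_imset_card.
(* The cap [n / 2] keeps the hull within the range of sparsity; the bound so obtained shows that the
   cap is not what stops the enlargement. *)
pose Q (B' : {set V}) := (2 * #|B'| <= n) &&
  [forall b in B', 4 * D <= 5 * #|spoiled e S (hull S B' L) (L b) b|].
have QB : Q B.
  by rewrite /Q (re_card st); apply/'forall_implyP => b; apply: (re_over st).
have [B' /maxsetP[/andP[cB' /'forall_implyP oB'] maxB'] sBB'] := maxset_exists QB.
have bound : 2 * (D * #|B'|) <= 12 * #|S| + 12 * #|B'|.
  apply: (card_overspoiled e_sym e_sparse (A := L)) => //.
  - by move=> b w _; apply: L_adj.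
  - apply: leq_trans (@card_hull_le _ S B' L D _) _; first by move=> b _; rewrite L_card.
    by rewrite /D; nia.
(* Since [D >= 100], [bound] yields [188 * #|B'| <= 12 * n], which leaves room for one more vertex;
   [1 < n] settles the case of empty [B']. *)
have cB'1 : 2 * #|B'|.+1 <= n by move: bound; rewrite /D; case: #|B'| => [|m]; nia.
have free' v : v \notin B' -> 5 * #|spoiled e S (hull S B' L) (L v) v| < 4 * D.
  move=> vB'; rewrite ltnNge; apply/negP=> over.
  have sB'v : B' \subset v |: B' by apply: subsetUr.
  have Qv : Q (v |: B').
    rewrite /Q cardsU1 vB' add1n cB'1; apply/'forall_implyP => b bB.
    have: 4 * D <= 5 * #|spoiled e S (hull S B' L) (L b) b|.
      by case/setU1P: bB => [->|/oB'].
    move=> h; apply: leq_trans h _; rewrite leq_mul2l /=.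
    by apply/subset_leq_card/spoiledS => //; apply: hullS.
  by move: vB'; rewrite -(maxB' _ Qv sB'v) setU11.
pose P := occupied S B F; pose C := B' :\: B.
(* Even with slack 35, more than [20 * Delta - 7] list elements are unspoiled, enough for the
   [10 * Delta] candidates from which the transversal picks [Delta]. *)
have cand c : c \in C -> exists2 Y : {set V},
    Y \subset L c :\: spoiled e P P (L c) c & #|Y| = 10 * Delta.
  case/setDP=> _ cB; apply: exists_subset_card.
  have := cardsDS (spoiled_sub e P P (L c) c); rewrite L_card => ->.
  by have := re_free st cB; rewrite -/P /D; lia.
have [A [sA cA]] : exists A : V -> {set V},
    (forall c, c \in C -> A c \subset L c :\: spoiled e P P (L c) c) /\
    (forall c, c \in C -> #|A c| = 10 * Delta).
  pose ok c (Y : {set V}) := (Y \subset L c :\: spoiled e P P (L c) c) && (#|Y| == 10 * Delta).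
  (* On [C] the default [set0] is never reached, by [cand]. *)
  exists (fun c => odflt set0 [pick Y | ok c Y]).
  by split=> c cC; case: pickP => [Y /andP[? /eqP]|/=] // no; have [Y s1 s2] := cand c cC;
    have := no Y; rewrite /ok s1 s2 eqxx.
have A_adj c w : c \in C -> w \in A c -> e c w.
  by move=> cC /(subsetP (sA c cC))/setDP[/L_adj].
have A_free c w : c \in C -> w \in A c -> w \notin P.
  move=> cC /(subsetP (sA c cC))/setDP[wL /spoiledP nsp].
  by apply/negP=> wP; apply: nsp; split=> //; left.
have A_nbr c w x : c \in C -> w \in A c -> x \in P -> e w x -> x = c.
  move=> cC /(subsetP (sA c cC))/setDP[wL /spoiledP nsp] xP wx.
  by apply/eqP/negP=> /negP xc; apply: nsp; split=> //; right; exists x.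
have cC : #|C| <= #|B'| by apply: subset_leq_card; apply: subsetDl.
have [|||G [GA Gdisj Gedge]] :=
  @independent_transversal _ e (D.+1 * n) e_sym e_sparse C A (10 * Delta) Delta cA A_adj.
- by lia.
- by lia.
- by rewrite /D; nia.
pose F' b := if b \in B then F b else G b.
have B'P b : b \in B' -> b \notin B -> b \in C by move=> bB' bB; rewrite inE bB.
have GP c w : c \in C -> w \in G c -> w \in A c.
  by move=> cC' wG; have [/subsetP sG _] := GA c cC'; apply: sG.
have FP b w : b \in B -> w \in F b -> w \in P.
  by move=> bB wF; rewrite inE; apply/orP; right; apply/bigcupP; exists b.
have SP w : w \in S -> w \in P by move=> wS; rewrite inE wS.
have occP w : w \in occupied S B' F' -> w \in P \/ exists2 c, c \in C & w \in G c.
  case/setUP=> [/SP|/bigcupP[b bB']]; first by left.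
  rewrite /F'; case: ifP => [bB /(FP _ _ bB)|/negbT bB wG]; first by left.
  by right; exists b => //; apply: B'P.
have F'sub b : b \in B' -> F' b \subset L b /\ #|F' b| = Delta.
  move=> bB'; rewrite /F'; case: ifP => [bB|/negbT bB]; first exact: (re_sub st).
  have bC := B'P _ bB' bB; have [sG ->] := GA _ bC; split=> //.
  by apply: subset_trans sG _; apply: subset_trans (sA _ bC) _; apply: subsetDl.
have CB' c : c \in C -> c \in B' by case/setDP.
have F'C c : c \in C -> F' c = G c by case/setDP=> _ /negPf h; rewrite /F' h.
have F'B b : b \in B -> F' b = F b by rewrite /F' => ->.
exists B', F'; split=> //.
- exact: (re_inj st).
- exact: (re_ind st).
- move=> b c w bB' cB'0; rewrite /F'.
  case: ifP => [bB|/negbT bB]; case: ifP => [cB|/negbT cB] wb wc.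
  + exact: (re_disj st) wb wc.
  + by have /negP[] := A_free _ _ (B'P _ cB'0 cB) (GP _ _ (B'P _ cB'0 cB) wc); apply: (FP b).
  + by have /negP[] := A_free _ _ (B'P _ bB' bB) (GP _ _ (B'P _ bB' bB) wb); apply: (FP c).
  + by apply: Gdisj wb wc; apply: B'P.
- move=> p q /occP[pP|[c c1 pG]] /occP[qP|[c' c2 qG]] pq.
  + have [[]|[pB qF]|[qB pF]] := re_edge st pP qP pq.
    * by constructor 1.
    * by constructor 2; rewrite (subsetP sBB') // F'B.
    * by constructor 3; rewrite (subsetP sBB') // F'B.
  + have pE : p = c' by apply: (A_nbr _ q) => //; [exact: GP | rewrite e_sym].
    by constructor 2; rewrite pE CB' // F'C.
  + have qE : q = c by apply: (A_nbr _ p) => //; exact: GP.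
    by constructor 3; rewrite qE CB' // F'C.
  + have [qE|pE] := Gedge _ _ _ _ c1 c2 pG qG pq.
      by constructor 3; rewrite qE CB' // F'C.
    by constructor 2; rewrite pE CB' // F'C.
- move=> b w bB'; rewrite /F'; case: ifP => [bB|/negbT bB wG wS]; first exact: (re_used st).
  by have /negP[] := A_free _ _ (B'P _ bB' bB) (GP _ _ (B'P _ bB' bB) wG); apply: SP.
(* All reservations lie in the lists of [B']. An element of [L v] reserved for [b] is adjacent to
   [b], a hull vertex other than [v], so it is already spoiled with respect to the hull. *)
- move=> v vB'; rewrite addn0; apply: leq_ltn_trans (free' v vB').
  rewrite leq_mul2l /=; apply/subset_leq_card/subsetP=> w /spoiledP[wL H].
  have F'L x : x \in occupied S B' F' -> x \in S \/ exists2 b, b \in B' & x \in L b.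
    case/setUP=> [|/bigcupP[b bB' xF]]; first by left.
    by right; exists b => //; have [/subsetP sF _] := F'sub b bB'; apply: sF.
  apply/spoiledP; split=> //; case: H => [/F'L[|[b bB' wb]]|[x [xO xv wx]]].
  + by left.
  + right; exists b; split; first by rewrite !inE bB' orbT.
      by apply: contraNneq vB' => <-.
    by rewrite e_sym L_adj.
  + right; exists x; split=> //.
    case/F'L: xO => [xS|[b bB' xb]]; first by rewrite !inE xS.
    by rewrite inE; apply/orP; right; apply/bigcupP; exists b.
Qed.

Lemma extend_imset X phi y u : y \notin X ->
  (fun z => if z == y then u else phi z) @: (y |: X) = u |: phi @: X.
Proof.
move=> yX; rewrite imsetU1 eqxx; congr (_ |: _); apply: eq_in_imset => z zX.
by case: eqP zX yX => // -> ->.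
Qed.

Lemma extend_embedding X phi B F x y :
  0 < n -> reserving_embedding 0 X phi B F -> x \in X -> y \notin X -> t x y ->
  (forall z, z \in X -> t z y -> z = x) ->
  exists phi', reserving_embedding 35 (y |: X) phi' B F.
Proof.
move=> n0 st xX yX txy y_nbr; set S := phi @: X; pose P := occupied S B F.
have xS : phi x \in S by apply: imset_f.
have SP w : w \in S -> w \in P by move=> wS; rewrite inE wS.
have N16 : 16 <= D.+1 * n by rewrite /D; nia.
suff [u [uS vu u_nbr u_occ]] : exists u, [/\ u \notin S, e (phi x) u,
    forall q, q \in S -> e u q -> q = phi x &
    (phi x \in B /\ u \in F (phi x)) \/
    u \notin P /\ (forall q, q \in P -> e u q -> q = phi x)].
  exists (fun z => if z == y then u else phi z); set phi' := fun z => _.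
  have phi'X z : z \in X -> phi' z = phi z.
    by rewrite /phi'; case: eqP yX => // -> /negP.
  have phi'y : phi' y = u by rewrite /phi' eqxx.
  have tu z : z \in X -> t y z = e u (phi z).
    move=> zX; apply/idP/idP => [tyz|uz].
      by rewrite (y_nbr z zX) 1?t_sym // e_sym.
    have /(re_inj st)-> // := u_nbr _ (imset_f phi zX) uz.
    by rewrite t_sym.
  have uneq z : z \in X -> phi z <> u.
    by move=> zX zu; move: uS; rewrite -zu imset_f.
  have occE w : w \in occupied (u |: S) B F = (w == u) || (w \in P).
    by rewrite /P /occupied -setUA in_setU1.
  split; rewrite ?(extend_imset _ _ yX) -/S.
  - move=> z z' /setU1P[->|zX] /setU1P[->|z'X] //; rewrite ?phi'y ?phi'X //.
    + by move=> /esym/(uneq _ z'X).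
    + by move=> /(uneq _ zX).
    + exact: (re_inj st).
  - move=> z z' /setU1P[->|zX] /setU1P[->|z'X]; rewrite ?phi'y ?phi'X //.
    + by rewrite t_irr e_irr.
    + exact: tu.
    + by rewrite t_sym e_sym tu.
    + exact: (re_ind st).
  - exact: (re_sub st).
  - exact: (re_disj st).
  - have old p q : p \in P -> q \in P -> e p q ->
        [\/ p \in u |: S /\ q \in u |: S, p \in B /\ q \in F p | q \in B /\ p \in F q].
      move=> pP qP pq; case: (re_edge st pP qP pq) => [[pS qS]|?|?].
      - by constructor 1; rewrite !setU1r.
      - by constructor 2.
      - by constructor 3.
    case: u_occ => [[vB uF]|[uP u_free]].
      have uP : u \in P by rewrite inE; apply/orP; right; apply/bigcupP; exists (phi x).
      have occE' w : w \in occupied (u |: S) B F -> w \in P.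
        by rewrite occE => /orP[/eqP->|].
      by move=> p q /occE' pP /occE' qP; apply: old.
    move=> p q; rewrite !occE => /orP[/eqP->|pP] /orP[/eqP->|qP]; rewrite ?e_irr //.
    + move=> /(u_free _ qP)->; constructor 1; rewrite setU11; split=> //.
      by rewrite setU1r.
    + rewrite e_sym => /(u_free _ pP)->; constructor 1; rewrite setU11; split=> //.
      by rewrite setU1r.
    + exact: old.
  - move=> b w bB wF /setU1P[wu|wS]; last by rewrite setU1r // (re_used st bB wF).
    case: u_occ => [[vB uF]|[/negP[]]].
      by rewrite (re_disj st bB vB wF) ?wu // setU1r.
    by rewrite -wu inE; apply/orP; right; apply/bigcupP; exists b.
  - move=> v vB; have := re_free st vB; rewrite -/S -/P addn0.
    have -> : occupied (u |: S) B F = u |: P by rewrite /P /occupied setUA.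
    by have := card_spoiledU1 e_sym e_sparse P u N16 (@L_adj v); lia.
  - move=> b bB; apply: leq_trans (re_over st bB) _; rewrite leq_mul2l /=.
    by apply/subset_leq_card/spoiledS; [|apply: hullS]; rewrite ?subsetUr.
  - exact: (re_card st).
have [vB|vB] := boolP (phi x \in B).
  have [FL cF] := re_sub st vB.
  (* Used reservations are images of tree neighbours of [x] other than [y], and there are fewer than
     [Delta] of these. *)
  have /subsetPn[u uF uS] : ~~ (F (phi x) \subset S).
    apply/negP=> FS.
    have FN : F (phi x) \subset phi @: ([set z | t x z] :\ y).
      apply/subsetP=> w wF; have /imsetP[z zX wE] := subsetP FS _ wF.
      rewrite wE; apply: imset_f; rewrite !inE (re_ind st xX zX) -wE L_adj ?(subsetP FL) // andbT.
      by apply: contraNneq yX => <-.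
    have := leq_trans (subset_leq_card FN) (leq_imset_card _ _).
    have := t_deg x; rewrite /deg (cardsD1 y) inE txy cF; lia.
  have uP : u \in P by rewrite inE; apply/orP; right; apply/bigcupP; exists (phi x).
  exists u; split=> //; [by rewrite L_adj // (subsetP FL) | move=> q qS uq | by left].
  (* If [q] were reserved for [u], then [re_used] would put [u] in the image; if [u] is reserved for
     [q], disjointness of reservations gives [q = phi x]. *)
  case: (re_edge st uP (SP _ qS) uq) => [[uS']|[uB qF]|[qB uFq]].
  - by rewrite -/S (negPf uS) in uS'.
  - by have := re_used st uB qF qS; rewrite -/S (negPf uS).
  - exact: (re_disj st qB vB uFq uF).
have /subsetPn[u uL /spoiledP nsp] : ~~ (L (phi x) \subset spoiled e P P (L (phi x)) (phi x)).
  apply/negP=> /subset_leq_card; rewrite L_card.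
  by have := re_free st vB; rewrite -/S -/P; lia.
have uP : u \notin P by apply/negP=> uP; apply: nsp; split=> //; left.
have u_nbr q : q \in P -> e u q -> q = phi x.
  by move=> qP uq; apply/eqP/negP=> /negP qx; apply: nsp; split=> //; right; exists q.
exists u; split.
- by apply: contra uP; apply: SP.
- exact: L_adj.
- by move=> q /SP; apply: u_nbr.
- by right.
Qed.

Lemma initial_embedding (x : T) (v : V) : 0 < n ->
  reserving_embedding 0 [set x] (fun=> v) set0 (fun=> set0).
Proof.
move=> n0; have N16 : 16 <= D.+1 * n by rewrite /D; nia.
have occE : occupied ((fun=> v) @: [set x]) set0 (fun=> set0) = v |: set0.
  by rewrite /occupied imset_set1 big_set0 !setU0.
split; rewrite ?cards0 ?occE ?imset_set1 //; try by move=> b; rewrite in_set0.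
- by move=> y z /set1P-> /set1P->.
- by move=> y z /set1P-> /set1P->; rewrite t_irr e_irr.
- by move=> p q; rewrite !inE !orbF => /eqP-> /eqP->; rewrite e_irr.
- move=> w _; have := card_spoiledU1 e_sym e_sparse set0 v N16 (@L_adj w).
  have -> : spoiled e set0 set0 (L w) w = set0.
    by apply/setP=> z; rewrite [RHS]inE; apply/spoiledP => -[_ []]; [|case=> y []]; rewrite inE.
  by rewrite cards0 /D; lia.
Qed.

End Embedding.

(** * Growing a connected vertex set in a tree *)

Lemma connect_boundary (T : finType) (t : rel T) (X : {set T}) (x y : T) :
  connect t x y -> x \in X -> y \notin X ->
  exists a b, [/\ a \in X, b \notin X & t a b].
Proof.
case/connectP=> p + ->; elim: p x => [|z p IH] x /=; first by move=> _ ->.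
move=> /andP[xz zp] xX pX; have [zX|zX] := boolP (z \in X); first exact: IH zp zX pX.
by exists x, z.
Qed.

Definition set_connected (T : finType) (t : rel T) (X : {set T}) :=
  forall x y, x \in X -> y \in X -> connect [rel a b | [&& t a b, a \in X & b \in X]] x y.

Lemma set_connectedU1 (T : finType) (t : rel T) (X : {set T}) (x y : T) :
  symmetric t -> set_connected t X -> x \in X -> t x y -> set_connected t (y |: X).
Proof.
move=> t_sym Xc xX txy.
set r := [rel a b | [&& t a b, a \in y |: X & b \in y |: X]].
have r_sym : connect_sym r.
  by apply: sym_connect_sym => a b; rewrite /= t_sym [X in _ && X]andbC.
have toX z : z \in y |: X -> connect r x z.
  case/setU1P=> [->|zX]; first by apply: connect1; rewrite /= txy setU11 setU1r.
  apply: connect_sub (Xc x z xX zX) => a b /= /and3P[tab aX bX].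
  by apply: connect1; rewrite /= tab !setU1r.
by move=> a b aX bX; apply: connect_trans (toX b bX); rewrite r_sym toX.
Qed.

(** If [x] and [z] differ, a simple path between them inside [X] closes through [y] to a cycle on at
    least three vertices. *)
Lemma acyclic_unique_neighbour (T : finType) (t : rel T) (X : {set T}) (x z y : T) :
  symmetric t -> acyclic_graph t -> set_connected t X ->
  x \in X -> z \in X -> y \notin X -> t x y -> t z y -> z = x.
Proof.
move=> t_sym acy Xc xX zX yX txy tzy; apply/eqP/negP=> /negP zx.
have /connectP[p0 pth0 zE0] := Xc x z xX zX.
case/shortenP: pth0 zE0 => p pth up _ zE.
have pX : {subset p <= X}.
  elim: p (x) pth {up zE} => // a p IH b /= /andP[/and3P[_ _ aX] /IH pX] c.
  by rewrite inE => /orP[/eqP->|/pX].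
have tp : path t x p by apply: sub_path pth => a b /= /and3P[].
have p_gt0 : 0 < size p by case: (p) zE zx => //= -> /eqP.
have := acy [:: y, x & p]; rewrite cons_uniq up andbT /= => /(_ _ _)/negP; apply.
- rewrite inE negb_or (contraNneq _ yX) /= => [|->] //.
  by apply: contra yX; apply: pX.
- by [].
- by rewrite t_sym txy rcons_path tp -zE tzy.
Qed.

(** * Embedding the whole tree *)

Theorem theorem1p3 (Delta n : nat) (V : finType) (e : rel V) :
  0 < Delta -> 0 < n ->
  simple_graph e ->
  0 < #|V| ->
  (forall v : V, 10 ^ 7 * Delta <= deg e v) ->
  (forall v : V, Rle (INR (deg e v)) (exp (Rdiv (INR Delta) 1000000000))) ->
  (forall (S : {set V}) (f : rel V),
      is_subgraph e S f -> #|S| <= (10 ^ 7 * Delta + 1) * n ->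
      avg_deg_le_12_5 S f) ->
  forall (T : finType) (t : rel T),
    #|T| = n -> is_tree t -> (forall x : T, deg t x <= Delta) ->
    induced_copy t e.
Proof.
move=> Delta_gt0 n_gt0 [e_sym e_irr] /card_gt0P[v0 _] mindeg _ sparse T t cT.
move=> [[t_sym t_irr] [t_conn t_acyc]] t_deg.
have D_le : 100 * Delta <= 10 ^ 7 * Delta.
  by rewrite leq_mul2r (expnD 10 2 5) (leq_pmulr (10 ^ 2)) ?expn_gt0 ?orbT.
have e_sparse (S : {set V}) : #|S| <= (100 * Delta).+1 * n ->
    5 * (\sum_(v in S) sub_deg S e v) <= 12 * #|S|.
  move=> cS; have := sparse S [rel x y | [&& e x y, x \in S & y \in S]].
  rewrite /avg_deg_le_12_5 (eq_bigr (sub_deg S e)) => [|v vS]; first apply.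
  - by split=> // x y /=; rewrite e_sym [(y \in S) && _]andbC.
  - by apply: leq_trans cS _; rewrite leq_mul2r addn1 ltnS D_le orbT.
  - by apply: eq_card => w; rewrite !inE /= vS /=; case: (w \in S); rewrite ?andbT.
pose nbr v := [set w | e v w].
have [L L_sub L_card] : exists2 L : V -> {set V},
    forall v, L v \subset nbr v & forall v, #|L v| = 100 * Delta.
  have ex v := exists_subset_card (leq_trans D_le (mindeg v)).
  pose ok v (Y : {set V}) := (Y \subset nbr v) && (#|Y| == 100 * Delta).
  exists (fun v => odflt set0 [pick Y | ok v Y]) => v;
    by case: pickP => [Y /andP[? /eqP]|] // no; have [Y s1 s2] := ex v;
      have := no Y; rewrite /ok s1 s2 eqxx.
have L_adj v w : w \in L v -> e v w by move/(subsetP (L_sub v)); rewrite inE.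
have /card_gt0P[r _] : 0 < #|T| by rewrite cT.
(* Connectedness of [X] ensures that the next vertex has a single embedded neighbour; each round
   creates slack 35 and removes it again. *)
have step k : k < n -> exists X : {set T}, [/\ #|X| = k.+1, set_connected t X &
    exists phi B F, reserving_embedding Delta n e L t 0 X phi B F].
  elim: k => [|k IH] kn.
    exists [set r]; split; first by rewrite cards1.
      by move=> x y /set1P-> /set1P->; apply: connect0.
    by exists (fun=> v0), set0, (fun=> set0); apply: initial_embedding.
  have [X [cX Xc [phi [B [F st]]]]] := IH (ltnW kn).
  have /subsetPn[y' _ y'X] : ~~ ([set: T] \subset X).
    by apply/negP=> /subset_leq_card; rewrite cardsT cT cX; lia.
  have /card_gt0P[x' x'X] : 0 < #|X| by rewrite cX.
  have [x [y [xX yX txy]]] := connect_boundary (t_conn x' y') x'X y'X.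
  have y_nbr z : z \in X -> t z y -> z = x.
    by move=> zX tzy; apply: acyclic_unique_neighbour Xc _ _ yX _ tzy.
  have [phi' st'] := extend_embedding Delta_gt0 e_sym e_irr e_sparse L_adj L_card
    t_sym t_irr t_deg n_gt0 st xX yX txy y_nbr.
  have cyX : #|y |: X| = k.+2 by rewrite cardsU1 yX cX.
  have [||B' [F' st'']] := reserve_overspoiled Delta_gt0 e_sym e_sparse L_adj L_card _ _ st'.
  - by lia.
  - by rewrite cyX.
  exists (y |: X); split=> //; first exact: set_connectedU1 Xc xX txy.
  by exists phi', B', F'.
have [X [cX _ [phi [B [F st]]]]] := step n.-1 (eq_leq (prednK n_gt0)).
have XT x : x \in X.
  have /eqP-> : X == setT by rewrite eqEcard subsetT cardsT cT cX prednK ?leqnn.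
  by rewrite inE.
exists phi; split=> [x y|x y]; first exact: (re_inj st).
exact: (re_ind st).
Qed.
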